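(* Let $\Sigma=\begin{pmatrix}\Sigma_{11}&\Sigma_{12}\\ \Sigma_{21}&\Sigma_{22}\end{pmatrix}\in\mathbf\Sigma$ be a strictly positive definite covariance matrix and put $\tilde\Sigma_{11}=\Sigma_{11}-\Sigma_{12}\Sigma_{22}^{-1}\Sigma_{21}$. A minimizer $\Sigma(H^*,D^*,Q^* )$ of the problem $\min_{\Sigma_1\in\mathbf\Sigma_1}\mathcal I(\Sigma\|\Sigma_1)$ is given by $$Q^*=\Sigma_{22}^{1/2},\qquad H^*=\Sigma_{12}\Sigma_{22}^{-1/2},\qquad D^*=\Delta(\Sigma_{11}-\Sigma_{12}\Sigma_{22}^{-1}\Sigma_{21}),$$ corresponding to the minimizing matrix $$\Sigma^*=\Sigma(H^*,D^*,Q^* )=\begin{pmatrix}\Sigma_{12}\Sigma_{22}^{-1}\Sigma_{21}+\Delta(\Sigma_{11}-\Sigma_{12}\Sigma_{22}^{-1}\Sigma_{21})&\Sigma_{12}\\ \Sigma_{21}&\Sigma_{22}\end{pmatrix}.$$ Moreover, $\mathcal I(\Sigma\|\Sigma^* )=\mathcal I(\tilde\Sigma_{11}\|\Delta(\tilde\Sigma_{11}))$, and the Pythagorean rule $$\mathcal I(\Sigma\|\Sigma_1)=\mathcal I(\Sigma\|\Sigma^* )+\mathcal I(\Sigma^*\|\Sigma_1)$$ holds for any $\Sigma_1=\Sigma(H,D,Q)\in\mathbf\Sigma_1$.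
   Context: For two covariance (symmetric nonnegative definite) matrices $\Sigma_1,\Sigma_2$ of the same size $m\times m$, $\mathcal I(\Sigma_1\|\Sigma_2)$ denotes the I-divergence (Kullback-Leibler divergence) of $N(0,\Sigma_1)$ with respect to $N(0,\Sigma_2)$ ($+\infty$ if the first law is not absolutely continuous with respect to the second). If both matrices are strictly positive definite, $\mathcal I(\Sigma_1\|\Sigma_2)=\frac12\log\frac{|\Sigma_2|}{|\Sigma_1|}-\frac m2+\frac12\mathrm{tr}(\Sigma_2^{-1}\Sigma_1)$. $n,k$ are positive integers with $k<n$. $\mathbf\Sigma$ is the set of all $(n+k)\times(n+k)$ covariance matrices, written in blocks with $\Sigma_{11}$ of size $n\times n$ and $\Sigma_{22}$ of size $k\times k$. $\mathbf\Sigma_1$ is the set of all matrices of the form $\Sigma(H,D,Q)=\begin{pmatrix}HH^\top+D&HQ\\ (HQ)^\top&Q^\top Q\end{pmatrix}$ with $H\in\mathbb{R}^{n\times k}$, $D\in\mathbb{R}^{n\times n}$ diagonal with $D\ge0$, and $Q\in\mathbb{R}^{k\times k}$ invertible. For a square matrix $M$, $\Delta(M)$ is the diagonal matrix with the same diagonal as $M$. For nonnegative definite $P$, $P^{1/2}$ denotes any (square) matrix with $(P^{1/2})^\top P^{1/2}=P$, and $P^{-1/2}$ is its inverse, if it exists (the same choice of $\Sigma_{22}^{1/2}$ is used throughout). *)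

(* Defs.v *)
From HB Require Import structures.
From mathcomp Require Import all_boot all_order all_algebra.
From mathcomp Require Import all_classical all_reals all_analysis.
From mathcomp Require Import measurable_realfun.

Set Implicit Arguments.
Unset Strict Implicit.
Unset Printing Implicit Defensive.

Import Order.TTheory GRing.Theory Num.Theory.
Import numFieldNormedType.Exports.

Local Open Scope classical_set_scope.
Local Open Scope ring_scope.

Section CovarianceMatrices.
Context {R : realType}.

Definition covmx m : set 'M[R]_m :=
  [set S | S \is symmetricmx /\ forall u : 'rV[R]_m, 0 <= (u *m S *m u^T) 0 0].

Definition posdefmx m (S : 'M[R]_m) : Prop :=
  S \is symmetricmx /\
  forall u : 'rV[R]_m, u != 0 -> 0 < (u *m S *m u^T) 0 0.

Definition Delta m (M : 'M[R]_m) : 'M[R]_m := diag_mx (\row_i M i i).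

Definition Sigma_of n k (H : 'M[R]_(n, k)) (D : 'M[R]_n) (Q : 'M[R]_k) :
  'M[R]_(n + k) :=
  block_mx (H *m H^T + D) (H *m Q) (H *m Q)^T (Q^T *m Q).

Definition HDQ_params n k (H : 'M[R]_(n, k)) (D : 'M[R]_n) (Q : 'M[R]_k) :
  Prop :=
  [/\ is_diag_mx D, forall i, 0 <= D i i & Q \in unitmx].

Definition Sigma1_set n k : set 'M[R]_(n + k) :=
  [set S | exists H D Q, @HDQ_params n k H D Q /\ S = Sigma_of H D Q].

End CovarianceMatrices.

Section GaussianLaws.
Context {R : realType}.

(* R^m is represented by tuples, which carry the product sigma-algebra (the
   library provides none on matrices); [measurableTypeR R] is R with its Borel
   sets. *)
Local Notation "''R^' m" := (m.-tuple (measurableTypeR R))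
  (at level 8, m at level 2, format "''R^' m").

Definition tuple_cons m (x : measurableTypeR R * 'R^m) : 'R^m.+1 :=
  [the m.+1.-tuple _ of x.1 :: x.2].

Lemma measurable_tuple_cons m : measurable_fun setT (@tuple_cons m).
Proof. exact: measurable_cons. Qed.

HB.instance Definition _ m :=
  isMeasurableFun.Build _ _ _ _ (@tuple_cons m) (@measurable_tuple_cons m).

(* Law of m independent standard normal variables. *)
Fixpoint std_gaussian (m : nat) : probability 'R^m R :=
  match m with
  | 0 => \d_[tuple]
  | m'.+1 => distribution (normal_prob 0 1 \x std_gaussian m')%E (@tuple_cons m')
  end.

Definition mx_act m (A : 'M[R]_m) (x : 'R^m) : 'R^m :=
  [tuple (A *m \col_j tnth x j) i 0 | i < m].

Lemma measurable_mx_act m (A : 'M[R]_m) : measurable_fun setT (mx_act A).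
Proof.
apply/measurable_fun_tnthP => i.
rewrite (_ : _ \o _ = fun x : 'R^m => \sum_j A i j * tnth x j).
  apply: measurable_sum => j.
  apply: measurableT_comp (mulrl_measurable _) _.
  exact: measurable_tnth.
apply/funext => x /=; rewrite tnth_mktuple mxE.
by apply: eq_bigr => j _; rewrite mxE.
Qed.

HB.instance Definition _ m (A : 'M[R]_m) :=
  isMeasurableFun.Build _ _ _ _ (mx_act A) (measurable_mx_act A).

(* Some square A with A^T *m A = S, which exists iff S is in [covmx m]. *)
Definition mxsqrt m (S : 'M[R]_m) : 'M[R]_m :=
  xget 0 [set A : 'M[R]_m | A^T *m A = S].

(* N(0, S), as the law of A^T Z with A^T A = S and Z standard normal; by
   rotation invariance of Z it does not depend on which A [mxsqrt] picks.
   S may be singular. *)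
Definition gaussian m (S : 'M[R]_m) : probability 'R^m R :=
  distribution (std_gaussian m) (mx_act (mxsqrt S)^T).

End GaussianLaws.

Local Open Scope ereal_scope.
Local Open Scope charge_scope.

Definition KL_div (d : measure_display) (T : measurableType d) (R : realType)
    (P Q : probability T R) : \bar R :=
  if `[< P `<< Q >]
  then \int[P]_x lne (('d (charge_of_finite_measure P) '/d Q) x)
  else +oo.

Definition Idiv (R : realType) m (S1 S2 : 'M[R]_m) : \bar R :=
  KL_div (gaussian S1) (gaussian S2).

(* Main.v *)
Require Import Defs.
From HB Require Import structures.
From mathcomp Require Import all_boot all_order all_algebra.
From mathcomp Require Import all_classical all_reals all_analysis.
From mathcomp Require Import ring lra measurable_realfun.

Set Implicit Arguments.
Unset Strict Implicit.
Unset Printing Implicit Defensive.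

Import Order.TTheory GRing.Theory Num.Theory.
Import numFieldNormedType.Exports.

Local Open Scope classical_set_scope.
Local Open Scope ring_scope.

(** Every term of the statement reduces to a closed formula in the covariance
    matrices, after which the claims are block linear algebra.

    Two Gaussian laws with invertible covariances S1 and S2 satisfy
      I(S1 || S2) = (ln (det S2 / det S1) + tr (S2^-1 S1) - m) / 2
    ([Idiv_unit]), and I(S1 || S2) = +oo if S1 is invertible and S2 is not
    ([Idiv_singular]).  Let S1 = Sigma(H,D,Q) be invertible.  Its Schur
    complement with respect to the lower right block is D, so the upper left
    block of S1^-1 is D^-1, a diagonal matrix.  Since S and Sigma^* differ only
    in the upper left block, and there by a matrix with zero diagonal,
    tr (S1^-1 S) = tr (S1^-1 Sigma^* ) ([mxtrace_invmx_Sigma_of]).  Applied to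
    S1 = Sigma^* this gives tr (Sigma^*^-1 S) = n + k, and with this the
    Pythagorean rule is the additivity of the logarithm.  If S1 is singular,
    both sides are +oo.  Minimality follows from the rule and nonnegativity of
    the divergence ([Idiv_ge0]).  The value I(S || Sigma^* ) is half of
    ln (det Sigma^* / det S), where the factor det S22 cancels.

    The closed formula comes from the density of the law of A Z with respect to
    the law of B Z, for Z standard normal and A, B invertible.  It rests on the
    linear change of variables for the Lebesgue integral over R^m
    ([scales_Lebint_unit]), proved by induction on m: an invertible matrix is a
    product of block triangular ones with a 1 x 1 corner, and for those Tonelli's
    theorem separates a one-dimensional affine substitution from an affine
    substitution in dimension m - 1.  The expectation of the logarithm of the
    density needs E (w Z)^2 = |w|^2 ([ge0_integral_linform2]).  This follows from
    the same change of variables: with B = 1 + r w^T w it gives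
    E exp (- s (w Z)^2) in closed form for small s of either sign, and
    exp y >= 1 + y turns this into an upper and a lower bound for E (w Z)^2 that
    meet as r tends to 0. *)

(** * Block matrices and square roots *)

(** Both sides are the determinant of the bordered matrix with blocks
    1, - v, u, 1, eliminated from either corner. *)
Lemma det1D_col_row (R : comNzRingType) m (u : 'cV[R]_m) (v : 'rV[R]_m) :
  \det (1%:M + u *m v) = 1 + (v *m u) 0 0.
Proof.
have E1 : block_mx 1%:M (- v) u 1%:M =
    block_mx 1%:M 0 u 1%:M *m block_mx 1%:M (- v) 0 (1%:M + u *m v).
  rewrite mulmx_block !mul1mx !mul0mx !mulmx1 !addr0 mulmxN.
  by rewrite addrCA addNr addr0.
have E2 : block_mx 1%:M (- v) u 1%:M =
    block_mx 1%:M (- v) 0 1%:M *m block_mx (1%:M + v *m u) 0 u 1%:M.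
  by rewrite mulmx_block !mul1mx !mul0mx !mulmx1 !add0r mulNmx addrK.
have := congr1 determinant E1; rewrite {1}E2 !det_mulmx !det_ublock !det_lblock.
by rewrite !det1 !mul1r !mulr1 => <-; rewrite det_mx11 !mxE eqxx.
Qed.

Section LinearAlgebra.
Context {R : realType}.

Lemma symmetricmxP m (S : 'M[R]_m) : reflect (S^T = S) (S \is symmetricmx).
Proof.
rewrite is_hermitianmxE expr0 scale1r map_mx_id// eq_sym.
exact: eqP.
Qed.

Lemma rV_norm_eq0 m (w : 'rV[R]_m) : ((w *m w^T) 0 0 = 0) -> w = 0.
Proof.
rewrite mxE => /eqP; rewrite psumr_eq0 => [/allP w2|i _]; last first.
  by rewrite mxE -expr2 sqr_ge0.
apply/rowP => i; have := w2 i (mem_index_enum _).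
by rewrite !mxE mulf_eq0 orbb => /eqP.
Qed.

Lemma posdefmx_unit m (S : 'M[R]_m) : posdefmx S -> S \in unitmx.
Proof.
move=> [_ pos]; rewrite unitmxE unitfE; apply/negP => /det0P[u u0 uS].
by have := pos u u0; rewrite uS mul0mx mxE ltxx.
Qed.

Lemma invmx_gram k (Q : 'M[R]_k) : Q \in unitmx ->
  invmx (Q^T *m Q) = invmx Q *m invmx Q^T.
Proof.
move=> uQ; have uQT : Q^T \in unitmx by rewrite unitmx_tr.
have u : Q^T *m Q \in unitmx by rewrite unitmx_mul uQ uQT.
by apply: (can_inj (mulmxK u)); rewrite mulVmx// -mulmxA mulKmx// mulVmx.
Qed.

Section Schur.
Variables (n k : nat).
Variables (S11 : 'M[R]_n) (S12 : 'M[R]_(n, k)) (S21 : 'M[R]_(k, n)) (S22 : 'M[R]_k).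
Local Notation S := (block_mx S11 S12 S21 S22).
Local Notation Schur := (S11 - S12 *m invmx S22 *m S21).

Lemma block_mx_sym : S \is symmetricmx ->
  [/\ S11^T = S11, S12^T = S21, S21^T = S12 & S22^T = S22].
Proof. by move=> /symmetricmxP; rewrite tr_block_mx => /eq_block_mx[]. Qed.

Lemma posdefmx_dr : posdefmx S -> posdefmx S22.
Proof.
move=> [/block_mx_sym[_ _ _ s22] pos]; split; first exact/symmetricmxP.
move=> u u0; have u0' : row_mx 0 u != 0 :> 'rV_(n + k).
  by rewrite row_mx_eq0 negb_and u0 orbT.
have := pos _ u0'.
by rewrite mul_row_block !mul0mx !add0r tr_row_mx mul_row_col trmx0 mulmx0 add0r.
Qed.

(** The Schur complement at u is the quadratic form of S at the minimizer
    (u, - u S12 S22^-1) over all completions of u. *)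
Lemma posdefmx_Schur : posdefmx S -> posdefmx Schur.
Proof.
move=> pS; have u22 := posdefmx_unit (posdefmx_dr pS).
case: pS => /block_mx_sym[s11 s12 s21 s22] pos; split.
  apply/symmetricmxP.
  by rewrite linearB /= !trmx_mul trmx_inv s11 s12 s21 s22 mulmxA.
move=> u u0; pose v := row_mx u (- (u *m S12 *m invmx S22)).
have v0 : v != 0 by rewrite row_mx_eq0 negb_and u0.
have := pos _ v0; rewrite mul_row_block tr_row_mx mul_row_col.
rewrite !mulNmx mulmxKV// subrr mul0mx addr0.
by rewrite mulmxBr !mulmxA.
Qed.

Lemma det_Schur : S22 \in unitmx -> \det S = \det Schur * \det S22.
Proof.
move=> u22.
have -> : S = block_mx 1%:M (S12 *m invmx S22) 0 1%:M *m block_mx Schur 0 S21 S22.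
  rewrite mulmx_block !mul1mx !mul0mx !add0r mulmxKV//.
  by rewrite subrK.
by rewrite det_mulmx det_ublock det_lblock !det1 !mul1r.
Qed.

Lemma invmx_Schur : S22 \in unitmx -> S \in unitmx ->
  ulsubmx (invmx S) *m Schur = 1%:M.
Proof.
move=> u22 uS; have := mulVmx uS.
rewrite -{1}[invmx S]submxK mulmx_block scalar_mx_block => /eq_block_mx[E1 E2 _ _].
have {}E2 : ursubmx (invmx S) = - (ulsubmx (invmx S) *m S12 *m invmx S22).
  apply: (can_inj (mulmxK u22)); rewrite mulNmx mulmxKV//; apply/eqP.
  by rewrite -addr_eq0 addrC E2.
by rewrite -E1 E2 mulmxBr mulNmx !mulmxA.
Qed.

(** One step of a Cholesky factorization. *)
Lemma block_sqrtmx (C : 'M[R]_k) (A : 'M[R]_n) : S12 = S21^T ->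
  C^T *m C = S22 -> S22 \in unitmx -> A^T *m A = Schur ->
  exists B : 'M[R]_(n + k), B^T *m B = S.
Proof.
move=> s12 CS u22 AS; have uC : C \in unitmx.
  by move: u22; rewrite -CS unitmx_mul => /andP[].
have uCT : C^T \in unitmx by rewrite unitmx_tr.
exists (block_mx A 0 (invmx C^T *m S21) C).
rewrite tr_block_mx mulmx_block trmx0 !mul0mx !mulmx0 !add0r CS AS.
rewrite trmx_mul trmx_inv trmxK -s12 mulmxKV// mulKVmx//; congr block_mx.
by rewrite -CS invmx_gram// !mulmxA subrK.
Qed.

End Schur.

Lemma posdefmx_sqrt m (S : 'M[R]_m) : posdefmx S ->
  exists A : 'M[R]_m, A^T *m A = S.
Proof.
elim: m S => [|m IHm].
  by move=> S _; exists 0; apply/matrixP; case.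
(* The last coordinate is split off, as the lower right 1 x 1 block. *)
rewrite -addn1 => S; rewrite -[S]submxK => pS.
have p22 := posdefmx_dr pS.
have [A AS] := IHm _ (posdefmx_Schur pS).
have [/block_mx_sym[_ _ s21 _] _] := pS.
have s0 : 0 < drsubmx S 0 0.
  have [_ /(_ 1%:M)] := p22; rewrite trmx1 mul1mx mulmx1; apply.
  by apply/eqP => /matrixP/(_ 0 0)/eqP; rewrite !mxE eqxx oner_eq0.
apply: (block_sqrtmx (esym s21) _ (posdefmx_unit p22) AS
  (C := (Num.sqrt (drsubmx S 0 0))%:M)).
rewrite tr_scalar_mx -scalar_mxM -expr2 sqr_sqrtr ?ltW//.
by rewrite -mx11_scalar.
Qed.

Lemma diag_sqrt m (D : 'M[R]_m) : is_diag_mx D -> (forall i, 0 <= D i i) ->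
  exists A : 'M[R]_m, A^T *m A = D.
Proof.
move=> /diag_mxP[d ->] d0.
exists (diag_mx (\row_i Num.sqrt (d 0 i))).
rewrite tr_diag_mx mulmx_diag; congr diag_mx; apply/rowP => i.
by rewrite !mxE -expr2 sqr_sqrtr//; have := d0 i; rewrite !mxE eqxx.
Qed.

(** The inverse of a diagonal matrix is diagonal, so only the diagonal of X
    contributes. *)
Lemma mxtrace_diag_eq0 m (D E X : 'M[R]_m) : is_diag_mx D -> E *m D = 1%:M ->
  (forall i, X i i = 0) -> \tr (E *m X) = 0.
Proof.
move=> /diag_mxP[d ->] ED X0.
have Eij i j : i != j -> E i j = 0.
  move=> ij; have /matrixP/(_ j j) := ED; have /matrixP/(_ i j) := ED.
  rewrite mul_mx_diag !mxE eqxx (negbTE ij) => /eqP; rewrite mulf_eq0.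
  by case/orP => /eqP -> //; rewrite mulr0 => /esym/eqP; rewrite oner_eq0.
rewrite /mxtrace big1// => i _; rewrite mxE big1// => j _.
by have [<-|ij] := eqVneq i j; rewrite ?X0 ?mulr0// Eij// mul0r.
Qed.

Lemma Schur_Sigma_of n k (H : 'M[R]_(n, k)) (D : 'M[R]_n) (Q : 'M[R]_k) :
  Q \in unitmx ->
  H *m H^T + D - (H *m Q) *m invmx (Q^T *m Q) *m (H *m Q)^T = D.
Proof.
move=> uQ; have uQT : Q^T \in unitmx by rewrite unitmx_tr.
by rewrite invmx_gram// trmx_mul !mulmxA mulmxK// mulmxKV// addrC addKr.
Qed.

Lemma Delta_diagE m (M : 'M[R]_m) i : Delta M i i = M i i.
Proof. by rewrite !mxE eqxx. Qed.

Lemma mxtrace_Delta_eq0 m (D E T : 'M[R]_m) : is_diag_mx D -> E *m D = 1%:M ->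
  \tr (E *m (T - Delta T)) = 0.
Proof.
move=> Dd ED; apply: mxtrace_diag_eq0 Dd ED _ => i.
by rewrite !mxE eqxx subrr.
Qed.

Section Sigma_of.
Variables (n k : nat) (H : 'M[R]_(n, k)) (D : 'M[R]_n) (Q : 'M[R]_k).
Hypothesis par : HDQ_params H D Q.

Let uQ : Q^T *m Q \in unitmx.
Proof. by case: par => _ _ uQ; rewrite unitmx_mul unitmx_tr uQ. Qed.

(** D may be singular here, so the law of covariance Sigma(H,D,Q) is covered in
    all cases. *)
Lemma Sigma_of_sqrt : exists A : 'M[R]_(n + k), A^T *m A = Sigma_of H D Q.
Proof.
case: par => Dd D0 Qu; have [A AD] := diag_sqrt Dd D0.
apply: (block_sqrtmx (C := Q) (A := A)) => //; first by rewrite trmxK.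
by rewrite Schur_Sigma_of.
Qed.

Lemma det_Sigma_of : \det (Sigma_of H D Q) = \det D * \det (Q^T *m Q).
Proof. by case: par => _ _ Qu; rewrite det_Schur// Schur_Sigma_of. Qed.

(** The upper left block of Sigma(H,D,Q)^-1 is the inverse of the diagonal
    matrix D, which does not see the off-diagonal part of T. *)
Lemma mxtrace_invmx_Sigma_of (T : 'M[R]_n) (S S' : 'M[R]_(n + k)) :
  Sigma_of H D Q \in unitmx ->
  S - S' = block_mx (T - Delta T) 0 0 0 ->
  \tr (invmx (Sigma_of H D Q) *m S) = \tr (invmx (Sigma_of H D Q) *m S').
Proof.
move=> u SS'; apply/eqP; rewrite -subr_eq0 -raddfB/= -mulmxBr SS'.
case: par => Dd _ Qu.
have := invmx_Schur uQ u; rewrite Schur_Sigma_of// => ED.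
rewrite -[invmx _]submxK mulmx_block !mulmx0 !addr0 mxtrace_block.
by rewrite mxtrace0 addr0; apply/eqP; exact: mxtrace_Delta_eq0 Dd ED.
Qed.

End Sigma_of.

Lemma det_sqrt_gt0 m (S A : 'M[R]_m) : A^T *m A = S -> S \in unitmx -> 0 < \det S.
Proof.
move=> <-; rewrite unitmxE unitfE det_mulmx det_tr -expr2 => d0.
by rewrite lt0r d0 sqr_ge0.
Qed.

End LinearAlgebra.

(** * Measures with a density *)

Section Density.
Local Open Scope ereal_scope.
Local Open Scope charge_scope.
Context d (T : measurableType d) (R : realType).
Variables (P : probability T R) (mu : {sigma_finite_measure set T -> \bar R}).
Variable h : T -> R.
Hypothesis h_ge0 : forall x, (0 <= h x)%R.
Hypothesis mh : measurable_fun [set: T] h.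
Hypothesis hP : forall A, measurable A -> P A = \int[mu]_(x in A) (h x)%:E.

Let measurable_Eh : measurable_fun [set: T] (EFin \o h).
Proof. exact/measurable_EFinP. Qed.

Lemma density_dominates : P `<< mu.
Proof.
apply/null_content_dominatesP => A mA muA0; rewrite hP//.
by apply: null_set_integral => //; exact: measurable_funTS.
Qed.

Lemma density_Radon_Nikodym :
  ae_eq mu setT ('d (charge_of_finite_measure P) '/d mu) (EFin \o h).
Proof.
apply: integral_ae_eq => //.
  by apply: Radon_Nikodym_integrable; exact: density_dominates.
move=> E _ mE; rewrite -Radon_Nikodym_integral//; first by rewrite /= hP.
exact: density_dominates.
Qed.

Lemma ge0_integral_density (f : T -> \bar R) :
  measurable_fun [set: T] f -> (forall x, 0 <= f x) ->
  \int[P]_x f x = \int[mu]_x (f x * (h x)%:E).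
Proof.
move=> mf f0; have Pmu := density_dominates.
rewrite -(@Radon_Nikodym_SigmaFinite.change_of_variables _ _ _ P mu)//.
have fint := Radon_Nikodym_SigmaFinite.f_integrable Pmu.
apply: ge0_ae_eq_integral => //.
- by apply: emeasurable_funM => //; exact: measurable_int fint.
- exact: emeasurable_funM.
- by move=> x _; rewrite mule_ge0// Radon_Nikodym_SigmaFinite.f_ge0.
- by move=> x _; rewrite mule_ge0// lee_fin.
- apply: ae_eqe_mul2l; apply: integral_ae_eq => //.
  by move=> E _ mE; rewrite -Radon_Nikodym_SigmaFinite.f_integral//= hP.
Qed.

End Density.

Lemma measurable_lne (R : realType) d (T : measurableType d) (f : T -> \bar R) :
  (forall x, f x \is a fin_num) -> measurable_fun setT f ->
  measurable_fun setT (fun x => lne (f x)).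
Proof.
move=> finf mf.
have mff : measurable_fun setT (fun x => fine (f x)) by exact: measurableT_comp.
rewrite (_ : (fun x => _) = fun x => (if (fine (f x) <= 0)%R then -oo else
    (ln (fine (f x)))%:E)%E); last first.
  by apply/funext => x; rewrite -{1}(fineK (finf x)).
apply: measurable_fun_ifT => //; first exact: measurable_fun_ler.
by apply/measurable_EFinP; exact: measurableT_comp.
Qed.

(** * Affine changes of variable *)

Section Lebesgue.
Local Open Scope ereal_scope.
Context {R : realType}.
Local Notation mu := (@lebesgue_measure R).
Local Notation RT := (measurableTypeR R).
Let aff1 (a c : R) (x : RT) : RT := (a * x + c)%R.

Let measurable_aff1 a c : measurable_fun setT (aff1 a c).
Proof.
apply: (@measurable_funD _ _ _ setT (fun x : RT => (a * x)%R) (cst c)) => //.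
exact: mulrl_measurable.
Qed.

(** Lebesgue measure is the image of itself under the map, times |a|: the two
    agree on the half-open intervals. *)
Lemma ge0_integral_lebesgue_affine (a c : R) (f : RT -> \bar R) :
  a != 0%R -> measurable_fun setT f -> (forall x, 0 <= f x) ->
  \int[mu]_x f x = `|a|%:E * \int[mu]_x f (a * x + c)%R.
Proof.
move=> a0 mf f0; have na0 : (0 <= `|a|)%R by [].
pose pm := measure_function_pushforward__canonical__measure_function_Measure
  mu (measurable_aff1 a c).
pose nu := mscale (NngNum na0) pm.
have Hnu A : measurable A -> mu A = nu A.
  apply: lebesgue_measure_unique => _ [[p q]] _ <-.
  rewrite lebesgue_measure_itv/= lte_fin /nu /mscale /= /pushforward.
  have [a_lt0|a_gt0|a_eq0] := ltgtP a 0%R; last by rewrite a_eq0 eqxx in a0.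
    (* For a < 0 the preimage of ]p, q] is closed on the left. *)
    rewrite [X in mu X](_ : _ = `[((q - c) / a)%R, ((p - c) / a)%R[%classic); last first.
      apply/seteqP; split => x; rewrite /= !in_itv/= /aff1.
        by rewrite ler_ndivrMr// ltr_ndivlMr// lerBrDr ltrBlDr mulrC andbC.
      by rewrite ler_ndivrMr// ltr_ndivlMr// lerBrDr ltrBlDr mulrC andbC.
    rewrite lebesgue_measure_itv/= lte_fin ltr_nM2r ?invr_lt0// ltrD2r.
    case: ifPn => _; rewrite ?mule0// -!EFinB -EFinM ltr0_norm//.
    by congr (_%:E); field; rewrite lt_eqF.
  rewrite [X in mu X](_ : _ = `]((p - c) / a)%R, ((q - c) / a)%R]%classic); last first.
    apply/seteqP; split => x; rewrite /= !in_itv/= /aff1.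
      by rewrite ler_pdivlMr// ltr_pdivrMr// lerBrDr ltrBlDr mulrC.
    by rewrite ler_pdivlMr// ltr_pdivrMr// lerBrDr ltrBlDr mulrC.
  rewrite lebesgue_measure_itv/= lte_fin ltr_pM2r ?invr_gt0// ltrD2r.
  case: ifPn => _; rewrite ?mule0// -!EFinB -EFinM gtr0_norm//.
  by congr (_%:E); field; rewrite gt_eqF.
transitivity (\int[nu]_x f x).
  by apply: eq_measure_integral => A mA _; exact: Hnu.
by rewrite ge0_integral_mscale//; congr (_ * _); rewrite ge0_integral_pushforward.
Qed.

End Lebesgue.

Section Gaussian.
Local Open Scope ereal_scope.
Local Open Scope charge_scope.
Context {R : realType}.
Local Notation RT := (measurableTypeR R).
Local Notation "''R^' m" := (m.-tuple RT)
  (at level 8, m at level 2, format "''R^' m").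
Local Notation N01 := (normal_prob (0 : R) 1).
Local Notation law C := (distribution (std_gaussian _) (mx_act C)).

Lemma ge0_integral_std_gaussianS m (f : 'R^m.+1 -> \bar R) :
  measurable_fun setT f -> (forall x, 0 <= f x) ->
  \int[std_gaussian m.+1]_x f x =
  \int[N01]_x \int[std_gaussian m]_t f (tuple_cons (x, t)).
Proof.
move=> mf f0; rewrite ge0_integral_distribution// fubini_tonelli1//; last first.
  by move=> y; exact: f0.
by apply: measurableT_comp mf _; exact: measurable_tuple_cons.
Qed.

Lemma ge0_integral_std_gaussianS_swap m (f : 'R^m.+1 -> \bar R) :
  measurable_fun setT f -> (forall x, 0 <= f x) ->
  \int[std_gaussian m.+1]_x f x =
  \int[std_gaussian m]_t \int[N01]_x f (tuple_cons (x, t)).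
Proof.
move=> mf f0; rewrite ge0_integral_distribution// fubini_tonelli2//; last first.
  by move=> y; exact: f0.
by apply: measurableT_comp mf _; exact: measurable_tuple_cons.
Qed.

Definition tuple_col m (x : 'R^m) : 'cV[R]_m := \col_j tnth x j.

Definition aff_act m (B : 'M[R]_m) (c : 'cV[R]_m) (x : 'R^m) : 'R^m :=
  [tuple (B *m tuple_col x + c)%R i 0%R | i < m].

Definition sqnorm m (x : 'R^m) : R := (\sum_i tnth x i ^+ 2)%R.

Definition gweight m (x : 'R^m) : R := expR (sqnorm x / 2).

(** Up to the constant (2 pi)^(m/2), the Lebesgue integral over R^m: the weight
    cancels the Gaussian density.  Written against a probability, it is
    accessible to Tonelli's theorem without sigma-finiteness arguments. *)
Definition Lebint m (f : 'R^m -> \bar R) : \bar R :=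
  \int[std_gaussian m]_x (f x * (gweight x)%:E).

Lemma tuple_col_aff_act m B c (x : 'R^m) :
  tuple_col (aff_act B c x) = (B *m tuple_col x + c)%R.
Proof. by apply/colP => i; rewrite !mxE tnth_mktuple !mxE. Qed.

Lemma tuple_col_inj m : injective (@tuple_col m).
Proof.
by move=> x y /colP xy; apply: eq_from_tnth => i; have := xy i; rewrite !mxE.
Qed.

Lemma tuple_col_cons m x (t : 'R^m) :
  tuple_col (tuple_cons (x, t)) = col_mx (x%:M) (tuple_col t) :> 'cV_(1 + m).
Proof.
apply/colP => i; rewrite !mxE.
case: splitP => j ij; rewrite !mxE.
  rewrite (_ : i = ord0); last by apply/val_inj; rewrite /= ij (ord1 j).
  by rewrite (ord1 j) eqxx.
rewrite (_ : i = lift ord0 j); last by apply/val_inj; rewrite /= ij.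
by rewrite tnthS/=; congr (tnth _ _); apply/val_inj.
Qed.

Lemma aff_act_comp m (B C : 'M[R]_m) (c : 'cV[R]_m) :
  aff_act B c \o aff_act C 0%R = aff_act (B *m C)%R c.
Proof.
apply/funext => x; apply: tuple_col_inj; rewrite /= !tuple_col_aff_act addr0.
by rewrite mulmxA.
Qed.

Lemma aff_act_mx_act m (B : 'M[R]_m) : aff_act B 0%R = mx_act B.
Proof.
by apply/funext => x; apply: eq_from_tnth => i; rewrite !tnth_mktuple addr0.
Qed.

Lemma measurable_aff_act m (B : 'M[R]_m) c : measurable_fun setT (aff_act B c).
Proof.
apply/measurable_fun_tnthP => i.
rewrite (_ : _ \o _ = fun x : 'R^m => (\sum_j B i j * tnth x j + c i 0)%R).
  apply: measurable_funD => //; apply: measurable_sum => j.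
  apply: measurableT_comp (mulrl_measurable _) _.
  exact: measurable_tnth.
apply/funext => x /=; rewrite tnth_mktuple !mxE; congr (_ + _)%R.
by apply: eq_bigr => j _; rewrite mxE.
Qed.

Lemma measurable_sqnorm m : measurable_fun setT (@sqnorm m).
Proof.
apply: measurable_sum => i; apply: measurable_funX.
exact: measurable_tnth.
Qed.

Lemma measurable_gweight m : measurable_fun setT (@gweight m).
Proof.
apply: measurableT_comp => //; apply: measurable_funM => //.
exact: measurable_sqnorm.
Qed.

Lemma gweight_gt0 m (x : 'R^m) : (0 < gweight x)%R.
Proof. exact: expR_gt0. Qed.

Lemma sqnorm_cons m x (t : 'R^m) :
  sqnorm (tuple_cons (x, t)) = (x ^+ 2 + sqnorm t)%R.
Proof.
rewrite /sqnorm big_ord_recl (_ : tnth _ ord0 = x) ?tnth0//.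
by congr (_ + _)%R; apply: eq_bigr => i _; rewrite tnthS.
Qed.

Lemma gweight_cons m x (t : 'R^m) :
  gweight (tuple_cons (x, t)) = (expR (x ^+ 2 / 2) * gweight t)%R.
Proof. by rewrite /gweight sqnorm_cons mulrDl expRD. Qed.

Definition Lebint1 (f : RT -> \bar R) : \bar R :=
  \int[N01]_x (f x * (expR (x ^+ 2 / 2))%:E).

Let measurable_expRsq : measurable_fun setT (fun x : RT => expR (x ^+ 2 / 2)).
Proof.
by apply: measurableT_comp => //; apply: measurable_funM.
Qed.

Lemma Lebint1E (f : RT -> \bar R) :
  measurable_fun setT f -> (forall x, 0 <= f x) ->
  Lebint1 f = (normal_peak (1 : R))%:E * \int[lebesgue_measure]_x f x.
Proof.
move=> mf f0.
rewrite /Lebint1 (@ge0_integral_density _ _ _ _ lebesgue_measure (normal_pdf 0 1))//.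
- rewrite -ge0_integralZl//; last by rewrite lee_fin normal_peak_ge0.
  apply: eq_integral => x _; rewrite normal_pdfE ?oner_eq0// /normal_fun.
  rewrite subr0 expr1n -muleA -EFinM muleC; congr (_%:E * _).
  rewrite mulrC -mulrA -expRD -[X in _ = X]mulr1; congr (_ * _)%R.
  by rewrite -[RHS]expR0; congr expR; field.
- by move=> x; exact: normal_pdf_ge0.
- exact: measurable_normal_pdf.
- by apply: emeasurable_funM => //; exact/measurable_EFinP.
- by move=> x; rewrite mule_ge0// lee_fin expR_ge0.
Qed.

Lemma Lebint1_affine (a c : R) (f : RT -> \bar R) : a != 0%R ->
  measurable_fun setT f -> (forall x, 0 <= f x) ->
  Lebint1 f = `|a|%:E * Lebint1 (fun x => f (a * x + c)%R).
Proof.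
move=> a0 mf f0; rewrite !Lebint1E//; last first.
  apply: measurableT_comp mf _.
  apply: (@measurable_funD _ _ _ setT (fun x : RT => (a * x)%R) (cst c)) => //.
  exact: mulrl_measurable.
by rewrite (ge0_integral_lebesgue_affine c a0)// muleCA.
Qed.

Lemma Lebint1_ge0 (f : RT -> \bar R) : (forall x, 0 <= f x) -> 0 <= Lebint1 f.
Proof.
by move=> f0; apply: integral_ge0 => x _; rewrite mule_ge0// lee_fin expR_ge0.
Qed.

Lemma Lebint1Zl (k : R) (f : RT -> \bar R) :
  measurable_fun setT f -> (forall x, 0 <= f x) -> (0 <= k)%R ->
  Lebint1 (fun x => k%:E * f x) = k%:E * Lebint1 f.
Proof.
move=> mf f0 k0; rewrite /Lebint1 -ge0_integralZl//.
- by apply: eq_integral => x _; rewrite muleA.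
- by apply: emeasurable_funM => //; exact/measurable_EFinP.
- by move=> x _; rewrite mule_ge0// lee_fin expR_ge0.
Qed.

Lemma Lebint_ge0 m (f : 'R^m -> \bar R) : (forall x, 0 <= f x) -> 0 <= Lebint f.
Proof.
move=> f0; apply: integral_ge0 => x _.
by rewrite mule_ge0// lee_fin ltW// gweight_gt0.
Qed.

Lemma LebintZl m (k : R) (f : 'R^m -> \bar R) :
  measurable_fun setT f -> (forall x, 0 <= f x) -> (0 <= k)%R ->
  Lebint (fun x => k%:E * f x) = k%:E * Lebint f.
Proof.
move=> mf f0 k0; rewrite /Lebint -ge0_integralZl//.
- by apply: eq_integral => x _; rewrite muleA.
- by apply: emeasurable_funM => //; apply/measurable_EFinP; exact: measurable_gweight.
- by move=> x _; rewrite mule_ge0// lee_fin ltW// gweight_gt0.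
Qed.

Section slices.
Variables (m : nat) (f : 'R^m.+1 -> \bar R).
Hypotheses (mf : measurable_fun setT f) (f0 : forall x, 0 <= f x).

Let measurable_f_cons : measurable_fun setT (f \o @tuple_cons R m).
Proof. by apply: measurableT_comp mf _; exact: measurable_tuple_cons. Qed.

Let g : RT * 'R^m -> \bar R := fun z => f (tuple_cons z) * (gweight z.2)%:E.

Let mg : measurable_fun setT g.
Proof.
apply: emeasurable_funM => //; apply/measurable_EFinP.
by apply: measurableT_comp => //; exact: measurable_gweight.
Qed.

Let g0 z : 0 <= g z.
Proof. by rewrite mule_ge0// lee_fin ltW// gweight_gt0. Qed.

Lemma measurable_slice_r (x : RT) :
  measurable_fun setT (fun t : 'R^m => f (tuple_cons (x, t))).
Proof. exact: measurableT_comp measurable_f_cons _. Qed.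

Lemma measurable_slice_l (t : 'R^m) :
  measurable_fun setT (fun x : RT => f (tuple_cons (x, t))).
Proof. exact: measurableT_comp measurable_f_cons _. Qed.

Lemma measurable_Lebint_slice :
  measurable_fun setT (fun x => Lebint (fun t : 'R^m => f (tuple_cons (x, t)))).
Proof. exact: (measurable_fun_fubini_tonelli_F g). Qed.

Let mfw : measurable_fun setT (fun x => f x * (gweight x)%:E).
Proof.
by apply: emeasurable_funM => //; apply/measurable_EFinP; exact: measurable_gweight.
Qed.

Let fw0 x : 0 <= f x * (gweight x)%:E.
Proof. by rewrite mule_ge0// lee_fin ltW// gweight_gt0. Qed.

Lemma LebintS :
  Lebint f = Lebint1 (fun x => Lebint (fun t => f (tuple_cons (x, t)))).
Proof.
rewrite {1}/Lebint ge0_integral_std_gaussianS//; apply: eq_integral => x _.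
rewrite -ge0_integralZr.
- by apply: eq_integral => t _; rewrite gweight_cons [(expR _ * _)%R]mulrC EFinM muleA.
- exact: measurableT.
- by apply: emeasurable_funM; [exact: measurable_slice_r|
    apply/measurable_EFinP; exact: measurable_gweight].
- by move=> t _; exact: (g0 (x, t)).
- by rewrite lee_fin expR_ge0.
Qed.

Lemma LebintS_swap :
  Lebint f = Lebint (fun t => Lebint1 (fun x => f (tuple_cons (x, t)))).
Proof.
rewrite {1}/Lebint ge0_integral_std_gaussianS_swap//; apply: eq_integral => t _.
rewrite -ge0_integralZr.
- by apply: eq_integral => x _; rewrite gweight_cons EFinM muleA.
- exact: measurableT.
- by apply: emeasurable_funM; [exact: measurable_slice_l|exact/measurable_EFinP].
- by move=> x _; rewrite mule_ge0// lee_fin expR_ge0.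
- by rewrite lee_fin ltW// gweight_gt0.
Qed.

Lemma measurable_Lebint1_slice :
  measurable_fun setT (fun t : 'R^m => Lebint1 (fun x => f (tuple_cons (x, t)))).
Proof.
pose g' := fun z : RT * 'R^m => f (tuple_cons z) * (expR (z.1 ^+ 2 / 2))%:E.
apply: (@measurable_fun_fubini_tonelli_G _ _ _ _ _ N01 g').
  apply: emeasurable_funM => //; apply/measurable_EFinP.
  exact: (measurableT_comp measurable_expRsq).
by move=> z; rewrite /g' mule_ge0// lee_fin expR_ge0.
Qed.

End slices.

(** The translation c is part of the property because the induction needs it:
    for a block triangular matrix, the substitution in one group of coordinates
    is translated by an amount depending on the others. *)
Definition scales_Lebint m (B : 'M[R]_m) : Prop :=
  forall (c : 'cV[R]_m) (f : 'R^m -> \bar R),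
    measurable_fun setT f -> (forall x, 0 <= f x) ->
  Lebint f = `|\det B|%:E * Lebint (f \o aff_act B c).

Lemma scales_LebintM m (B C : 'M[R]_m) :
  scales_Lebint B -> scales_Lebint C -> scales_Lebint (B *m C)%R.
Proof.
move=> okB okC c f mf f0.
have mfB : measurable_fun setT (f \o aff_act B c).
  by apply: measurableT_comp mf _; exact: measurable_aff_act.
rewrite (okB c _ mf f0) (okC 0%R _ mfB (fun x => f0 _)).
by rewrite det_mulmx normrM EFinM -muleA -compA aff_act_comp.
Qed.

Lemma aff_act_cons_lower m (a : R) l (B : 'M[R]_m) (c : 'cV[R]_(1 + m))
    (x : RT) (t : 'R^m) :
  aff_act (block_mx a%:M 0 l B : 'M[R]_(1 + m))%R c (tuple_cons (x, t)) =
  tuple_cons ((a * x + usubmx c 0 0)%R, aff_act B (l *m x%:M + dsubmx c)%R t).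
Proof.
apply: tuple_col_inj; rewrite tuple_col_aff_act !tuple_col_cons tuple_col_aff_act.
rewrite mul_block_col mul0mx addr0 -scalar_mxM -{1}(vsubmxK c) add_col_mx.
congr col_mx; last by rewrite addrA [X in (X + _)%R]addrC.
by rewrite [usubmx c]mx11_scalar -raddfD/= !mxE.
Qed.

Lemma aff_act_cons_upper m (a : R) u (B : 'M[R]_m) (c : 'cV[R]_(1 + m))
    (x : RT) (t : 'R^m) :
  aff_act (block_mx a%:M u 0 B : 'M[R]_(1 + m))%R c (tuple_cons (x, t)) =
  tuple_cons ((a * x + (u *m tuple_col t + usubmx c) 0 0)%R, aff_act B (dsubmx c)%R t).
Proof.
apply: tuple_col_inj; rewrite tuple_col_aff_act !tuple_col_cons tuple_col_aff_act.
rewrite mul_block_col mul0mx add0r -scalar_mxM -{1}(vsubmxK c) add_col_mx.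
congr col_mx; rewrite -addrA [(u *m _ + _)%R in LHS]mx11_scalar.
by rewrite -raddfD.
Qed.

(** For a fixed first coordinate, the others undergo an affine substitution with
    matrix B; then the first one is rescaled by a. *)
Lemma scales_Lebint_lower m (a : R) l (B : 'M[R]_m) : a != 0%R ->
  scales_Lebint B -> scales_Lebint (block_mx a%:M 0 l B : 'M[R]_(1 + m))%R.
Proof.
move=> a0 okB c f mf f0.
have mfa : measurable_fun setT (f \o aff_act (block_mx a%:M 0 l B : 'M[R]_(1 + m))%R c).
  by apply: measurableT_comp mf _; exact: measurable_aff_act.
have f0a x : 0 <= (f \o aff_act (block_mx a%:M 0 l B : 'M[R]_(1 + m))%R c) x.
  exact: f0.
rewrite (LebintS mf f0) (LebintS mfa f0a).
rewrite (Lebint1_affine (usubmx c 0 0)%R a0 (measurable_Lebint_slice mf f0)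
  (fun x => Lebint_ge0 (fun t => f0 _))).
rewrite det_lblock det_scalar1 normrM EFinM -muleA; congr (_ * _).
rewrite -(Lebint1Zl (measurable_Lebint_slice mfa f0a)
  (fun x => Lebint_ge0 (fun t => f0a _)) (normr_ge0 _)).
congr Lebint1; apply/funext => x.
rewrite (okB (l *m x%:M + dsubmx c)%R _ (measurable_slice_r mf _) (fun t => f0 _)).
by congr (_ * Lebint _); apply/funext => t /=; rewrite aff_act_cons_lower.
Qed.

(** The order of integration is opposite to the lower triangular case: the first
    coordinate is substituted first, the others being fixed. *)
Lemma scales_Lebint_upper m (a : R) u (B : 'M[R]_m) : a != 0%R ->
  scales_Lebint B -> scales_Lebint (block_mx a%:M u 0 B : 'M[R]_(1 + m))%R.
Proof.
move=> a0 okB c f mf f0.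
have mfa : measurable_fun setT (f \o aff_act (block_mx a%:M u 0 B : 'M[R]_(1 + m))%R c).
  by apply: measurableT_comp mf _; exact: measurable_aff_act.
have f0a x : 0 <= (f \o aff_act (block_mx a%:M u 0 B : 'M[R]_(1 + m))%R c) x.
  exact: f0.
rewrite (LebintS_swap mf f0) (LebintS_swap mfa f0a).
rewrite (okB (dsubmx c) _ (measurable_Lebint1_slice mf f0)
  (fun t => Lebint1_ge0 (fun x => f0 _))).
rewrite det_ublock det_scalar1 mulrC normrM EFinM -muleA; congr (_ * _).
rewrite -(LebintZl (measurable_Lebint1_slice mfa f0a)
  (fun t => Lebint1_ge0 (fun x => f0a _)) (normr_ge0 _)).
congr Lebint; apply/funext => t.
rewrite /= (Lebint1_affine ((u *m tuple_col t + usubmx c) 0 0)%R a0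
  (measurable_slice_l mf _) (fun x => f0 _)).
by congr (_ * Lebint1 _); apply/funext => x /=; rewrite aff_act_cons_upper.
Qed.

Lemma scales_Lebint1 m : scales_Lebint (1%:M : 'M[R]_m).
Proof.
elim: m => [|m IHm].
  move=> c f mf f0; rewrite det1 normr1 mul1e; congr Lebint.
  by apply/funext => x /=; congr f; apply: eq_from_tnth; case.
rewrite -[m.+1]/(1 + m)%N scalar_mx_block.
by apply: scales_Lebint_lower; rewrite ?oner_eq0.
Qed.

(** Elimination with pivot the upper left entry.  A zero pivot is first made
    nonzero by adding another row to the first one, a block triangular
    operation. *)
Lemma scales_Lebint_unit m (B : 'M[R]_m) : B \in unitmx -> scales_Lebint B.
Proof.
elim: m B => [|m IHm].
  by move=> B _; rewrite (_ : B = 1%:M); [exact: scales_Lebint1|apply/matrixP; case].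
suff ok00 (C : 'M[R]_(1 + m)) :
    C \in unitmx -> C 0%R 0%R != 0%R -> scales_Lebint C.
  move=> B Bu; have [B00|] := eqVneq (B 0%R 0%R) 0%R; last by move=> ?; exact: ok00.
  have [i Bi0] : exists i : 'I_m, B (rshift 1 i) 0%R != 0%R.
    apply: contrapT => /forallNP Bi0; move: Bu; rewrite unitmxE unitfE.
    rewrite (expand_det_col B 0%R) big1 ?eqxx// => j _.
    case: (unliftP 0%R j) => [k ->|->]; last by rewrite B00 mul0r.
    have /negP := Bi0 k; rewrite negbK => /eqP.
    rewrite (_ : rshift 1 k = lift 0%R k); last exact/val_inj.
    by move->; rewrite mul0r.
  (* E e adds e times row i + 1 to row 0. *)
  pose E (e : R) : 'M[R]_(1 + m) := block_mx 1%:M (e *: delta_mx 0%R i)%R 0%R 1%:M.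
  have okE e : scales_Lebint (E e).
    exact: scales_Lebint_upper (oner_neq0 _) (@scales_Lebint1 m).
  have EE e : (E (- e)%R *m E e)%R = 1%:M.
    rewrite mulmx_block !mul1mx !mulmx1 !mul0mx !mulmx0 !addr0 add0r.
    by rewrite scaleNr subrr -scalar_mx_block.
  have -> : B = (E (-1) *m (E 1 *m B))%R :> 'M[R]_(1 + m).
    by rewrite mulmxA EE mul1mx.
  apply: scales_LebintM => //; apply: ok00.
    rewrite unitmx_mul Bu andbT.
    by have := EE 1%R => /mulmx1_unit[].
  have E10 : (E 1%R *m (B : 'M[R]_(1 + m)))%R 0%R 0%R = B (rshift 1 i) 0%R.
    rewrite -[B in LHS](submxK (B : 'M[R]_(1 + m))) mulmx_block scale1r !mul1mx.
    have E0 : 0%R = lshift m 0%R :> 'I_(1 + m) by exact/val_inj.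
    by rewrite [in LHS]E0 block_mxEul mxE -rowE !mxE -!E0 B00 add0r.
  by rewrite E10.
move=> Cu C00.
set a := C 0%R 0%R in C00.
pose S := (drsubmx C - dlsubmx C *m (a^-1 *: ursubmx C))%R.
have CE : C = (block_mx 1%:M 0 (a^-1 *: dlsubmx C) 1%:M *m
               block_mx a%:M (ursubmx C) 0 S)%R.
  rewrite mulmx_block !mul1mx !mul0mx !addr0 /S -[LHS]submxK.
  congr block_mx.
  - by rewrite [LHS]mx11_scalar !mxE /a; congr (C _ _)%:M; exact/val_inj.
  - by rewrite mul_mx_scalar scalerA divff// scale1r.
  - by rewrite -scalemxAl -scalemxAr addrC subrK.
have Su : S \in unitmx.
  move: Cu; rewrite CE unitmx_mul => /andP[_].
  by rewrite !unitmxE det_ublock unitrM => /andP[].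
rewrite CE; apply: scales_LebintM.
  exact: scales_Lebint_lower (oner_neq0 _) (@scales_Lebint1 m).
by apply: scales_Lebint_upper => //; exact: IHm.
Qed.

(** * Densities between linear images of the standard Gaussian law *)

Lemma sqnormE m (x : 'R^m) : sqnorm x = ((tuple_col x)^T *m tuple_col x)%R 0%R 0%R.
Proof. by rewrite mxE; apply: eq_bigr => i _; rewrite !mxE. Qed.

Lemma measurable_mx_act_comp m (B : 'M[R]_m) (f : 'R^m -> \bar R) :
  measurable_fun setT f -> measurable_fun setT (f \o mx_act B).
Proof. by move=> mf; apply: measurableT_comp mf _; exact: measurable_mx_act. Qed.

Lemma tuple_col_mx_act m (B : 'M[R]_m) (x : 'R^m) :
  tuple_col (mx_act B x) = (B *m tuple_col x)%R.
Proof. by rewrite -aff_act_mx_act tuple_col_aff_act addr0. Qed.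

Lemma mx_act_comp m (B C : 'M[R]_m) (x : 'R^m) :
  mx_act B (mx_act C x) = mx_act (B *m C)%R x.
Proof. by apply: tuple_col_inj; rewrite !tuple_col_mx_act mulmxA. Qed.

Lemma mx_act1 m (x : 'R^m) : mx_act (1%:M : 'M[R]_m)%R x = x.
Proof. by apply: tuple_col_inj; rewrite tuple_col_mx_act mul1mx. Qed.

(** The density of the law of A Z with respect to the law of B Z, for Z standard
    normal: the quotient of their Lebesgue densities
    exp (- |A^-1 y|^2 / 2) / |det A| and exp (- |B^-1 y|^2 / 2) / |det B|. *)
Definition linear_density m (A B : 'M[R]_m) (y : 'R^m) : R :=
  (`|\det B| / `|\det A| *
    (gweight (mx_act (invmx B) y) / gweight (mx_act (invmx A) y)))%R.

Lemma linear_density_gt0 m (A B : 'M[R]_m) y :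
  A \in unitmx -> B \in unitmx -> (0 < linear_density A B y)%R.
Proof.
rewrite !unitmxE !unitfE => A0 B0.
by rewrite mulr_gt0// divr_gt0 ?gweight_gt0// normr_gt0.
Qed.

Lemma measurable_linear_density m (A B : 'M[R]_m) :
  measurable_fun setT (linear_density A B).
Proof.
apply: measurable_funM => //.
have mg C : measurable_fun setT (fun y : 'R^m => gweight (mx_act C y)).
  by apply: measurableT_comp (measurable_mx_act C); exact: measurable_gweight.
rewrite (_ : (fun y => _) = (fun y : 'R^m => gweight (mx_act (invmx B) y) *
    expR (- (sqnorm (mx_act (invmx A) y) / 2)))%R); last first.
  by apply/funext => y; rewrite expRN.
apply: measurable_funM => //; apply: measurableT_comp => //.
apply: measurableT_comp => //; apply: measurable_funM => //.
by apply: measurableT_comp (measurable_mx_act _); exact: measurable_sqnorm.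
Qed.

(** Both sides are Lebesgue integrals of g(y) = f(y) exp (- |A^-1 y|^2 / 2) up to
    the factors |det A| and |det B|, after the substitutions y = A x and
    y = B x. *)
Lemma ge0_integral_std_gaussian_linear m (A B : 'M[R]_m) (f : 'R^m -> \bar R) :
  A \in unitmx -> B \in unitmx ->
  measurable_fun setT f -> (forall x, 0 <= f x) ->
  \int[std_gaussian m]_x f (mx_act A x) =
  \int[std_gaussian m]_x (f (mx_act B x) * (linear_density A B (mx_act B x))%:E).
Proof.
move=> Au Bu mf f0.
pose g y := f y * (gweight (mx_act (invmx A) y))^-1%:E.
have mg : measurable_fun setT g.
  apply: emeasurable_funM => //; apply/measurable_EFinP.
  rewrite (_ : (fun y => _) =
      (fun y : 'R^m => expR (- (sqnorm (mx_act (invmx A) y) / 2)))%R); last first.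
    by apply/funext => y; rewrite expRN.
  apply: measurableT_comp => //; apply: measurableT_comp => //.
  apply: measurable_funM => //.
  by apply: measurableT_comp (measurable_mx_act _); exact: measurable_sqnorm.
have g0 y : 0 <= g y by rewrite mule_ge0// lee_fin invr_ge0 ltW// gweight_gt0.
have detA0 : (0 < `|\det A|)%R by rewrite normr_gt0 -unitfE -unitmxE.
have gA := scales_Lebint_unit Au 0%R mg g0.
have gB := scales_Lebint_unit Bu 0%R mg g0.
rewrite !aff_act_mx_act in gA gB.
have LA : Lebint (g \o mx_act A) = \int[std_gaussian m]_x f (mx_act A x).
  apply: eq_integral => x _; rewrite /g/= mx_act_comp mulVmx// mx_act1.
  by rewrite -muleA -EFinM mulVf ?mule1// gt_eqF// gweight_gt0.
have -> : \int[std_gaussian m]_x f (mx_act A x) =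
    `|\det A|^-1%:E * (`|\det B|%:E * Lebint (g \o mx_act B)).
  rewrite -gB gA muleA -EFinM (mulVf (lt0r_neq0 detA0)) mul1e.
  exact: esym LA.
have mgB := measurable_mx_act_comp B mg.
have c0 : (0 <= `|\det A|^-1 * `|\det B|)%R by rewrite mulr_ge0 ?invr_ge0.
rewrite muleA -EFinM -(LebintZl mgB (fun x => g0 _) c0).
apply: eq_integral => x _; rewrite /g /linear_density /= !mx_act_comp mulVmx// mx_act1.
rewrite [X in X * _]muleCA -!muleA -!EFinM; congr (_ * _%:E).
by ring.
Qed.

(** * Second moments of the standard Gaussian law *)

Section linear_form.
Variables (m : nat) (w : 'rV[R]_m).

Definition linform (x : 'R^m) : R := ((w *m tuple_col x) 0 0)%R.
Let W : R := ((w *m w^T) 0 0)%R.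

Lemma measurable_linform : measurable_fun setT linform.
Proof.
rewrite (_ : linform = fun x : 'R^m => (\sum_j w 0 j * tnth x j)%R).
  apply: measurable_sum => j; apply: measurableT_comp (mulrl_measurable _) _.
  exact: measurable_tnth.
by apply/funext => x; rewrite /linform mxE; apply: eq_bigr => j _; rewrite mxE.
Qed.

Let W_ge0 : (0 <= W)%R.
Proof. by rewrite /W mxE sumr_ge0// => i _; rewrite mxE -expr2 sqr_ge0. Qed.

Let rank1_unit r : (1 + r * W != 0)%R -> (1%:M + (r *: w^T) *m w)%R \in unitmx.
Proof.
by move=> rW; rewrite unitmxE unitfE det1D_col_row -scalemxAr mxE.
Qed.

Let sqnorm_rank1 r (x : 'R^m) :
  sqnorm (mx_act (1%:M + (r *: w^T) *m w)%R x) =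
  (sqnorm x + (r *+ 2 + r ^+ 2 * W) * linform x ^+ 2)%R.
Proof.
rewrite !sqnormE tuple_col_mx_act mulmxDl mul1mx -mulmxA.
rewrite [(w *m tuple_col x)%R]mx11_scalar.
rewrite -/(linform x); set p := linform x.
have wxp : (w *m tuple_col x = p%:M)%R by rewrite [LHS]mx11_scalar.
have xwp : ((tuple_col x)^T *m w^T = p%:M)%R by rewrite -trmx_mul wxp tr_scalar_mx.
have -> : (tuple_col x + (r *: w^T) *m p%:M)^T%R =
    ((tuple_col x)^T + (p * r) *: w)%R.
  by rewrite mul_mx_scalar scalerA; apply/matrixP => i j; rewrite !mxE.
rewrite mul_mx_scalar scalerA mulmxDl !mulmxDr.
rewrite -!scalemxAl -!scalemxAr wxp xwp [(w *m w^T)%R]mx11_scalar -/W.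
rewrite [((tuple_col x)^T *m tuple_col x)%R]mx11_scalar.
set q := (_ *m _)%R 0%R 0%R.
by rewrite !mxE !eqxx /= !mulr1n; ring.
Qed.

(** The total mass of the law of Z, written as an integral against the law of
    B Z with B = 1 + r w^T w. *)
Let integral_expR_linform r : (0 < 1 + r * W)%R ->
  \int[std_gaussian m]_x
    (expR (- ((r *+ 2 + r ^+ 2 * W) / 2 * linform x ^+ 2)))%:E
  = ((1 + r * W)^-1)%:E.
Proof.
move=> rW; have Bu := rank1_unit (lt0r_neq0 rW).
set B := (1%:M + _)%R in Bu.
have detB : \det B = (1 + r * W)%R by rewrite det1D_col_row -scalemxAr mxE.
have one_ge0 (x : 'R^m) : 0 <= cst 1 x :> \bar R by [].
have := ge0_integral_std_gaussian_linear (unitmx1 _ _) Bu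
  (measurable_cst (1%E : \bar R)) one_ge0.
have -> : \int[std_gaussian m]_x cst 1 (mx_act 1%:M x) = 1 :> \bar R.
  by rewrite integral_cst//= mul1e probability_setT.
move=> intB.
have E x : cst 1 (mx_act B x) * (linear_density 1%:M B (mx_act B x))%:E =
    (1 + r * W)%:E *
    (expR (- ((r *+ 2 + r ^+ 2 * W) / 2 * linform x ^+ 2)))%:E.
  rewrite mul1e /linear_density det1 normr1 detB gtr0_norm// divr1.
  rewrite mx_act_comp mulVmx// mx_act1 -EFinM invmx1 mx_act1; congr (_ * _)%:E%R.
  rewrite /gweight -expRN -expRD; congr expR.
  by rewrite sqnorm_rank1; field.
rewrite (eq_integral _ _ (fun x _ => E x)) in intB.
have mE : measurable_fun setT (fun x : 'R^m =>
    (expR (- ((r *+ 2 + r ^+ 2 * W) / 2 * linform x ^+ 2)))%:E).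
  apply/measurable_EFinP; apply: measurableT_comp => //; apply: measurableT_comp => //.
  apply: measurable_funM => //; apply: measurable_funX; exact: measurable_linform.
rewrite ge0_integralZl_EFin// in intB; last by rewrite ltW.
have rW0 := lt0r_neq0 rW.
have := congr1 (mule ((1 + r * W)^-1)%:E) intB.
by rewrite mule1 muleA -EFinM (mulVf rW0) mul1e => ->.
Qed.

Let E := \int[std_gaussian m]_x (linform x ^+ 2)%:E.

Let mq : measurable_fun setT (fun x : 'R^m => (linform x ^+ 2)%:E).
Proof. by apply/measurable_EFinP/measurable_funX; exact: measurable_linform. Qed.

Let E_ge0 : 0 <= E.
Proof. by apply: integral_ge0 => x _; rewrite lee_fin sqr_ge0. Qed.

Let mexp s : measurable_fun setT
  (fun x : 'R^m => (expR (- (s * linform x ^+ 2)))%:E).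
Proof.
apply/measurable_EFinP; apply: measurableT_comp => //; apply: measurableT_comp => //.
by apply: measurable_funM => //; apply: measurable_funX; exact: measurable_linform.
Qed.

Let msq s : measurable_fun setT (fun x : 'R^m => s%:E * (linform x ^+ 2)%:E).
Proof. exact: measurable_funeM. Qed.

Let int_cst1 : \int[std_gaussian m]_x (1 : \bar R) = 1.
Proof. by rewrite integral_cst//= mul1e probability_setT. Qed.

(** Integrate exp y >= 1 + y at y = s (w x)^2, with - r in the formula above. *)
Let E_ub r : (0 < r)%R -> (r * W < 1)%R ->
  1 + ((r *+ 2 - r ^+ 2 * W) / 2)%:E * E <= ((1 - r * W)^-1)%:E.
Proof.
move=> r0 rW; set s := (_ / 2)%R.
have s0 : (0 <= s)%R by rewrite /s; nra.
have := @integral_expR_linform (- r)%R; rewrite mulNr => <-; last by rewrite subr_gt0.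
have sq_ge0 x : 0 <= s%:E * (linform x ^+ 2)%:E.
  by rewrite mule_ge0// lee_fin sqr_ge0.
rewrite -[leLHS](_ : \int[std_gaussian m]_x (1 + s%:E * (linform x ^+ 2)%:E) = _).
  apply: ge0_le_integral => //.
  - by move=> x _; rewrite adde_ge0.
  - exact: emeasurable_funD.
  move=> x _; rewrite -EFinM -EFinD lee_fin.
  apply: le_trans (expR_ge1Dx _) _; rewrite ler_expR /s sqrrN.
  by rewrite le_eqVlt; apply/orP; left; apply/eqP; field.
rewrite ge0_integralD// int_cst1 ge0_integralZl_EFin// => x _.
by rewrite lee_fin sqr_ge0.
Qed.

(** Integrate exp y >= 1 + y at y = - s (w x)^2, with r in the formula above. *)
Let E_lb r : (0 < r)%R ->
  1 <= ((1 + r * W)^-1)%:E + ((r *+ 2 + r ^+ 2 * W) / 2)%:E * E.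
Proof.
move=> r0; set s := (_ / 2)%R.
have s0 : (0 <= s)%R by rewrite /s; have := W_ge0; nra.
have rW : (0 < 1 + r * W)%R by rewrite ltr_pwDl// mulr_ge0// ltW.
rewrite -(integral_expR_linform rW) -/s.
have sq_ge0 x : 0 <= s%:E * (linform x ^+ 2)%:E.
  by rewrite mule_ge0// lee_fin sqr_ge0.
have exp_ge0 x : 0 <= (expR (- (s * linform x ^+ 2)))%:E.
  by rewrite lee_fin expR_ge0.
rewrite -(ge0_integralZl_EFin _ measurableT _ mq s0); last first.
  by move=> x _; rewrite lee_fin sqr_ge0.
rewrite -ge0_integralD// -[leLHS]int_cst1; apply: ge0_le_integral => //.
- exact: emeasurable_funD.
- move=> x _; rewrite -EFinM -EFinD lee_fin -lerBlDr.
  exact: expR_ge1Dx.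
Qed.

(** The bounds above, with r = t / (1 + W), give
    e (1 - 2 t) <= W <= e (1 + 2 t) for the second moment e and all small t. *)
Lemma ge0_integral_linform2 :
  \int[std_gaussian m]_x (linform x ^+ 2)%:E = ((w *m w^T) 0 0)%R%:E.
Proof.
rewrite -/E -/W.
have W1 : (0 < 1 + W)%R by rewrite ltr_pwDl.
pose k := ((1 + W)^-1)%R.
have k0 : (0 < k)%R by rewrite invr_gt0.
have kW : (k * W = 1 - k)%R.
  by rewrite -[X in (X - k)%R](mulVf (lt0r_neq0 W1)) -/k; ring.
have k1 : (k <= 1)%R by rewrite -subr_ge0 -kW mulr_ge0// ltW.
have /fineK Efin : E \is a fin_num.
  rewrite ge0_fin_numE//.
  have r0 : (0 < k / 2)%R by rewrite divr_gt0.
  have rW : (k / 2 * W < 1)%R by rewrite mulrAC kW; lra.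
  have := E_ub r0 rW; set s := ((_ - _) / 2)%R.
  have s0 : (0 < s)%R.
    by rewrite /s expr2 -mulrA [(k / 2 * W)%R]mulrAC kW; nra.
  by case: (E) E_ge0 => [x _|_|//]; rewrite ?ltry// gt0_muley ?lte_fin// addey.
move: E_ub E_lb E_ge0; rewrite -Efin; set e := fine E.
rewrite lee_fin => ub lb e0; congr _%:E.
have ub' t : (0 < t)%R -> (t <= 2^-1)%R -> (e * (1 - t *+ 2) <= W)%R.
  move=> t0 t2; have r0 : (0 < t * k)%R by rewrite mulr_gt0.
  have aE : (t * k * W = t * (1 - k))%R by rewrite -mulrA kW.
  have a1 : (t * k * W < 1)%R by rewrite aE; nra.
  have := ub _ r0 a1.
  rewrite -EFinM -EFinD lee_fin -[leRHS]div1r ler_pdivlMr ?subr_gt0//.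
  set a := (t * k * W)%R in aE a1 *.
  have -> : ((t * k) *+ 2 - (t * k) ^+ 2 * W = t * k * (2 - a))%R.
    by rewrite /a; ring.
  move=> H.
  have {}H : (t * k * (e * ((2 - a) / 2) * (1 - a)) <= t * k * W)%R.
    by rewrite -/a; nra.
  move: H; rewrite ler_pM2l// => H; apply: le_trans H.
  rewrite -mulrA; apply: ler_wpM2l => //.
  have at_ : (a <= t)%R by rewrite aE; nra.
  have a0 : (0 <= a)%R by rewrite aE; nra.
  nra.
have lb' t : (0 < t)%R -> (t <= 2^-1)%R -> (W <= e * (1 + t *+ 2))%R.
  move=> t0 t2; have r0 : (0 < t * k)%R by rewrite mulr_gt0.
  have aE : (t * k * W = t * (1 - k))%R by rewrite -mulrA kW.
  have := lb _ r0; rewrite -EFinM -EFinD lee_fin.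
  set a := (t * k * W)%R in aE *.
  have a0 : (0 <= a)%R by rewrite aE; nra.
  have a1 : (0 < 1 + a)%R by lra.
  have -> : ((t * k) *+ 2 + (t * k) ^+ 2 * W = t * k * (2 + a))%R.
    by rewrite /a; ring.
  rewrite -(ler_pM2r a1) mulrDl mulVf ?lt0r_neq0// => H.
  have {}H : (t * k * W <= t * k * (e * ((2 + a) / 2) * (1 + a)))%R.
    by rewrite -/a; nra.
  move: H; rewrite ler_pM2l// => H; apply: (le_trans H).
  rewrite -mulrA; apply: ler_wpM2l => //.
  have at_ : (a <= t)%R by rewrite aE; nra.
  nra.
have small (x : R) :
    (forall t, 0 < t -> t <= 2^-1 -> x <= t * (e *+ 2))%R -> (x <= 0)%R.
  move=> H; rewrite leNgt; apply/negP => x0.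
  (* At t = x / (2 (x + 2 e)) the bound gives 2 (x + 2 e) <= 2 e. *)
  have d0 : (0 < 2 * (x + e *+ 2))%R by rewrite mulr2n; lra.
  have t0 : (0 < x / (2 * (x + e *+ 2)))%R by rewrite divr_gt0.
  have := H _ t0; rewrite ler_pdivrMr//.
  have -> : (x <= 2^-1 * (2 * (x + e *+ 2)))%R.
    by rewrite mulrA mulVf// mul1r mulr2n; lra.
  move=> /(_ isT); rewrite mulrAC ler_pdivlMr//.
  by rewrite ler_pM2l// mulr2n; lra.
apply/eqP; rewrite eq_le -subr_le0 -[X in _ && X]subr_le0; apply/andP; split.
- by apply: small => t t0 t2; have := ub' t t0 t2; lra.
- by apply: small => t t0 t2; have := lb' t t0 t2; lra.
Qed.

End linear_form.

(** * Divergence between Gaussian laws *)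

Lemma sqnorm_mx_act m (C : 'M[R]_m) (x : 'R^m) :
  sqnorm (mx_act C x) = (\sum_i linform (row i C) x ^+ 2)%R.
Proof.
by apply: eq_bigr => i _; rewrite tnth_mktuple /linform -row_mul [in RHS]mxE.
Qed.

(** The squared norm of C Z is the sum of the squares of the linear forms given by
    the rows of C. *)
Lemma integral_sqnorm_mx_act m (C : 'M[R]_m) :
  \int[std_gaussian m]_x (sqnorm (mx_act C x))%:E = (\tr (C *m C^T))%:E.
Proof.
under eq_integral => x _ do rewrite sqnorm_mx_act -sumEFin.
rewrite ge0_integral_sum//; last 2 first.
- by move=> i; apply/measurable_EFinP/measurable_funX; exact: measurable_linform.
- by move=> i x _; rewrite lee_fin sqr_ge0.
under eq_bigr do rewrite ge0_integral_linform2.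
rewrite sumEFin; congr _%:E; apply: eq_bigr => i _.
by rewrite !mxE; apply: eq_bigr => j _; rewrite !mxE.
Qed.

Lemma sqnorm_ge0 m (x : 'R^m) : (0 <= sqnorm x)%R.
Proof. by apply: sumr_ge0 => i _; rewrite sqr_ge0. Qed.

Lemma integrable_sqnorm_mx_act m (C : 'M[R]_m) :
  (std_gaussian m).-integrable setT (fun x => (sqnorm (mx_act C x))%:E).
Proof.
apply/integrableP; split.
  apply/measurable_EFinP.
  by apply: measurableT_comp (measurable_mx_act _); exact: measurable_sqnorm.
under eq_integral => x _ do rewrite gee0_abs ?lee_fin ?sqnorm_ge0//.
by rewrite integral_sqnorm_mx_act ltry.
Qed.

Section law.
Variables (m : nat) (A B : 'M[R]_m).
Hypotheses (Au : A \in unitmx) (Bu : B \in unitmx).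

Lemma law_linear_density E : measurable E ->
  law A E = \int[law B]_(y in E) (linear_density A B y)%:E.
Proof.
move=> mE.
have mi : measurable_fun setT (fun y : 'R^m => (\1_E y : R)%:E).
  exact/measurable_EFinP/measurable_indic.
have i0 (y : 'R^m) : 0 <= (\1_E y : R)%:E by rewrite lee_fin.
have -> : law A E = \int[law A]_y (\1_E y : R)%:E by rewrite integral_indic// setIT.
rewrite ge0_integral_distribution// (ge0_integral_std_gaussian_linear Au Bu mi i0).
rewrite [RHS]integral_mkcond ge0_integral_distribution//; last 2 first.
- apply/(measurable_restrictT _ mE)/measurable_funTS.
  by apply/measurable_EFinP; exact: measurable_linear_density.
- by move=> y; apply: erestrict_ge0 => z _; rewrite lee_fin ltW// linear_density_gt0.
apply: eq_integral => x _; rewrite /= patchE indicE.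
by case: ifPn => _; rewrite ?mul1e ?mul0e.
Qed.

Lemma ln_linear_density x : ln (linear_density A B (mx_act A x)) =
  (ln (`|\det B| / `|\det A|) +
   2^-1 * (sqnorm (mx_act (invmx B *m A) x) - sqnorm (mx_act 1%:M x)))%R.
Proof.
have dA : (0 < `|\det A|)%R by rewrite normr_gt0 -unitfE -unitmxE.
have dB : (0 < `|\det B|)%R by rewrite normr_gt0 -unitfE -unitmxE.
rewrite /linear_density !mx_act_comp mulVmx//.
rewrite lnM ?posrE ?divr_gt0 ?gweight_gt0//; congr (_ + _)%R.
by rewrite -expRN -expRD expRK; field.
Qed.

(** The divergence of the law of A Z with respect to the law of B Z. *)
Definition linear_KL : R :=
  (ln (`|\det B| / `|\det A|) +
   2^-1 * (\tr ((invmx B *m A) *m (invmx B *m A)^T) - m%:R))%R.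

Lemma integrable_ln_linear_density :
  (std_gaussian m).-integrable setT
    (fun x => (ln (linear_density A B (mx_act A x)))%:E).
Proof.
rewrite (_ : (fun x => _) = fun x => (ln (`|\det B| / `|\det A|))%:E +
   2^-1%:E *
   ((sqnorm (mx_act (invmx B *m A) x))%:E - (sqnorm (mx_act 1%:M x))%:E)).
  apply: integrableD => //; first exact: finite_measure_integrable_cst.
  apply: integrableZl => //; apply: integrableB => //; exact: integrable_sqnorm_mx_act.
by apply/funext => x; rewrite ln_linear_density EFinD EFinM EFinB.
Qed.

Lemma integral_ln_linear_density :
  \int[std_gaussian m]_x (ln (linear_density A B (mx_act A x)))%:E = linear_KL%:E.
Proof.
under eq_integral => x _ do rewrite ln_linear_density EFinD EFinM EFinB.
have I1 := integrable_sqnorm_mx_act (invmx B *m A)%R.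
have I2 := integrable_sqnorm_mx_act (1%:M : 'M[R]_m)%R.
have I12 := integrableB measurableT I1 I2.
rewrite integralD//; last 2 first.
- exact: finite_measure_integrable_cst.
- exact: integrableZl.
rewrite integralZl// integralB// !integral_sqnorm_mx_act.
rewrite integral_cst//= probability_setT mule1.
by rewrite trmx1 mulmx1 mxtrace1.
Qed.

Lemma KL_div_linear : KL_div (law A) (law B) = linear_KL%:E.
Proof.
have dens0 y : (0 <= linear_density A B y)%R by rewrite ltW// linear_density_gt0.
have mdens := measurable_linear_density A B.
have densP := law_linear_density.
have dom := @density_dominates _ _ _ (law A) (law B) _ mdens densP.
have RN := density_Radon_Nikodym mdens densP.
rewrite /KL_div asboolT//.
have mRN : measurable_fun setT ('d (charge_of_finite_measure (law A)) '/d (law B)).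
  by apply: (measurable_int (law B)); exact: Radon_Nikodym_integrable.
have mln : measurable_fun setT (fun y => (ln (linear_density A B y))%:E).
  by apply/measurable_EFinP; exact: measurableT_comp.
transitivity (\int[law A]_y (ln (linear_density A B y))%:E).
  apply: ae_eq_integral => //.
    by apply: measurable_lne => // y; exact: Radon_Nikodym_fin_num.
  apply: (null_dominates_ae_eq measurableT dom).
  apply: filterS RN => y /(_ I) /= RNy _.
  by rewrite RNy lne_EFin// linear_density_gt0.
rewrite integral_distribution//; first exact: integral_ln_linear_density.
exact: integrable_ln_linear_density.
Qed.

(** The inverse density d has mean 1 under the law of A Z, and ln d <= d - 1. *)
Lemma linear_KL_ge0 : (0 <= linear_KL)%R.
Proof.
have mdens := measurable_linear_density B A.
have invd y : linear_density B A y = (linear_density A B y)^-1%R.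
  by rewrite /linear_density invfM !invf_div.
have md : measurable_fun setT (fun x => (linear_density B A (mx_act A x))%:E).
  by apply/measurable_EFinP; apply: measurableT_comp mdens (measurable_mx_act A).
have d0 y : (0 <= linear_density B A y)%R by rewrite ltW// linear_density_gt0.
have int1 : \int[std_gaussian m]_x (linear_density B A (mx_act A x))%:E = 1.
  have one_ge0 (x : 'R^m) : 0 <= cst 1 x :> \bar R by [].
  have := ge0_integral_std_gaussian_linear Bu Au
    (measurable_cst (1%E : \bar R)) one_ge0.
  have -> : \int[std_gaussian m]_x cst 1 (mx_act B x) = 1 :> \bar R.
    by rewrite integral_cst//= mul1e probability_setT.
  by move=> ->; apply: eq_integral => x _; rewrite mul1e.
have idens : (std_gaussian m).-integrable setT
    (fun x => (linear_density B A (mx_act A x))%:E).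
  apply/integrableP; split => //.
  under eq_integral => x _ do rewrite gee0_abs ?lee_fin//.
  by rewrite int1 ltry.
have icst : (std_gaussian m).-integrable setT (fun _ : 'R^m => 1%:E : \bar R).
  exact: finite_measure_integrable_cst.
have iln := integrable_ln_linear_density.
have le : \int[std_gaussian m]_x (1 - (ln (linear_density A B (mx_act A x)))%:E) <=
    \int[std_gaussian m]_x (linear_density B A (mx_act A x))%:E.
  apply: le_integral => //; first exact: integrableB.
  move=> x _; rewrite -EFinB lee_fin invd.
  rewrite -[X in (_ <= X^-1)%R]lnK ?posrE ?linear_density_gt0// -expRN.
  exact: expR_ge1Dx.
move: le; rewrite int1 integralB// integral_ln_linear_density//.
rewrite integral_cst//= mul1e probability_setT -EFinB lee_fin.
by rewrite gerDl oppr_le0.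
Qed.

End law.

(** The law of B Z is carried by a hyperplane u y = 0.  If the law of A Z were
    too, then u A Z = 0 almost surely, although E (u A Z)^2 = |u A|^2 > 0. *)
Lemma not_dominates_singular m (A B : 'M[R]_m) :
  A \in unitmx -> B \notin unitmx -> ~ law A `<< law B.
Proof.
move=> Au; rewrite unitmxE unitfE negbK => /det0P[u u0 uB].
move=> /null_content_dominatesP dom.
pose E : set 'R^m := linform u @^-1` (~` [set 0%R]).
have mE : measurable E.
  rewrite -[E]setTI; apply: measurable_linform => //.
  exact: measurableC.
have /(dom _ mE) : law B E = 0.
  rewrite /distribution /pushforward (_ : _ @^-1` _ = set0) ?measure0//.
  rewrite -subset0 => x /=; rewrite /E /linform /= tuple_col_mx_act mulmxA uB mul0mx.
  by rewrite mxE; apply.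
rewrite /distribution /pushforward => P0.
pose w := (u *m A)%R.
have w0 : w != 0%R.
  apply: contra u0 => /eqP w0; apply/eqP.
  by rewrite -[u](mulmxK Au) -/w w0 mul0mx.
have : \int[std_gaussian m]_x (linform w x ^+ 2)%:E = 0.
  rewrite -[RHS](_ : \int[std_gaussian m]_x (cst 0 x : \bar R) = _); last first.
    exact: integral0.
  apply: ae_eq_integral => //.
    by apply/measurable_EFinP/measurable_funX; exact: measurable_linform.
  exists (mx_act A @^-1` E); split => //.
    by rewrite -[X in measurable X]setTI; exact: measurable_mx_act.
  move=> x /= /not_implyP[_ wx]; rewrite /E /= => ux0; apply: wx.
  rewrite (_ : linform w x = 0%R) ?expr0n//.
  by rewrite -ux0 /linform tuple_col_mx_act mulmxA.
rewrite ge0_integral_linform2 => -[] /rV_norm_eq0 w_eq0.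
by rewrite w_eq0 eqxx in w0.
Qed.

Lemma mxsqrtP m (S A : 'M[R]_m) :
  (A^T *m A)%R = S -> ((mxsqrt S)^T *m mxsqrt S)%R = S.
Proof. by move=> AS; rewrite /mxsqrt; case: xgetP => [x _ //|/(_ A)]. Qed.

Lemma mxsqrt_unit m (S A : 'M[R]_m) : (A^T *m A)%R = S -> S \in unitmx ->
  (mxsqrt S)^T%R \in unitmx.
Proof.
by move=> /mxsqrtP AS; rewrite -{1}AS unitmx_mul => /andP[].
Qed.

(** The matrices A1 and A2 only witness that square roots exist; the formula holds
    for whichever square roots define the Gaussian laws. *)
Lemma Idiv_unit m (S1 S2 A1 A2 : 'M[R]_m) :
  (A1^T *m A1)%R = S1 -> (A2^T *m A2)%R = S2 -> S1 \in unitmx -> S2 \in unitmx ->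
  Idiv S1 S2 =
  (2^-1 * (ln (\det S2 / \det S1) + (\tr (invmx S2 *m S1) - m%:R)))%R%:E.
Proof.
move=> AS1 AS2 u1 u2; have U1 := mxsqrt_unit AS1 u1; have U2 := mxsqrt_unit AS2 u2.
rewrite /Idiv /gaussian KL_div_linear//; congr _%:E; rewrite /linear_KL [RHS]mulrDr.
have E1 := mxsqrtP AS1; have E2 := mxsqrtP AS2.
move: U1 U2 E1 E2; set B1 := mxsqrt S1; set B2 := mxsqrt S2.
move=> U1 U2 E1 E2.
have detS (B S : 'M[R]_m) : (B^T *m B)%R = S -> \det S = (`|\det B^T| ^+ 2)%R.
  by move=> <-; rewrite det_mulmx det_tr -expr2 real_normK ?num_real.
have d1 : (0 < `|\det B1^T|)%R by rewrite normr_gt0 -unitfE -unitmxE.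
have d2 : (0 < `|\det B2^T|)%R by rewrite normr_gt0 -unitfE -unitmxE.
congr (_ + _)%R.
  rewrite (detS _ _ E1) (detS _ _ E2) -expr_div_n lnXn ?divr_gt0//.
  by field.
congr (_ * (_ - _))%R.
rewrite trmx_mul trmxK mulmxA -[(_ *m B1^T *m B1)%R]mulmxA E1 -mulmxA mxtrace_mulC.
rewrite -mulmxA mxtrace_mulC; congr (\tr _); congr (_ *m _)%R.
have uB2 : B2 \in unitmx by rewrite -unitmx_tr.
by rewrite -E2 (invmx_gram uB2) trmx_inv trmxK.
Qed.

Lemma Idiv_singular m (S1 S2 A1 A2 : 'M[R]_m) :
  (A1^T *m A1)%R = S1 -> (A2^T *m A2)%R = S2 -> S1 \in unitmx -> S2 \notin unitmx ->
  Idiv S1 S2 = +oo.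
Proof.
move=> AS1 AS2 u1 u2; rewrite /Idiv /KL_div asboolF//.
apply: not_dominates_singular; first exact: mxsqrt_unit AS1 u1.
apply: contra u2; rewrite -{2}(mxsqrtP AS2) unitmx_mul => u2.
by rewrite u2 -unitmx_tr.
Qed.

Lemma Idiv_ge0 m (S1 S2 A1 A2 : 'M[R]_m) :
  (A1^T *m A1)%R = S1 -> (A2^T *m A2)%R = S2 -> S1 \in unitmx -> S2 \in unitmx ->
  0 <= Idiv S1 S2.
Proof.
move=> AS1 AS2 u1 u2; have U1 := mxsqrt_unit AS1 u1; have U2 := mxsqrt_unit AS2 u2.
by rewrite /Idiv /gaussian KL_div_linear// lee_fin linear_KL_ge0.
Qed.

End Gaussian.

(** * The Pythagorean rule *)

Theorem proposition4p7 (R : realType) (n k : nat)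
    (k_gt0 : (0 < k)%N) (k_lt_n : (k < n)%N)
    (S11 : 'M[R]_n) (S12 : 'M[R]_(n, k)) (S21 : 'M[R]_(k, n)) (S22 : 'M[R]_k)
    (S_cov : covmx (block_mx S11 S12 S21 S22))
    (S_posdef : posdefmx (block_mx S11 S12 S21 S22))
    (sqrtS22 : 'M[R]_k) (sqrtS22P : sqrtS22^T *m sqrtS22 = S22) :
  let S := block_mx S11 S12 S21 S22 in
  let tS11 := S11 - S12 *m invmx S22 *m S21 in
  let Qs := sqrtS22 in
  let Hs := S12 *m invmx sqrtS22 in
  let Ds := Delta (S11 - S12 *m invmx S22 *m S21) in
  let Ss := Sigma_of Hs Ds Qs in
  [/\ HDQ_params Hs Ds Qs,
      forall S1, Sigma1_set S1 -> (Idiv S Ss <= Idiv S S1)%E,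
      Ss = block_mx
             (S12 *m invmx S22 *m S21 + Delta (S11 - S12 *m invmx S22 *m S21))
             S12 S21 S22,
      Idiv S Ss = Idiv tS11 (Delta tS11)
    & forall (H : 'M[R]_(n, k)) (D : 'M[R]_n) (Q : 'M[R]_k),
        HDQ_params H D Q ->
        Idiv S (Sigma_of H D Q) = (Idiv S Ss + Idiv Ss (Sigma_of H D Q))%E].
Proof.
move=> S tS11 Qs Hs Ds Ss.
have p22 := posdefmx_dr S_posdef.
have pT : posdefmx tS11 := posdefmx_Schur S_posdef.
have u22 := posdefmx_unit p22.
have uS : S \in unitmx := posdefmx_unit S_posdef.
have uT : tS11 \in unitmx := posdefmx_unit pT.
have [AS AS_eq] := posdefmx_sqrt S_posdef.
have [AT AT_eq] := posdefmx_sqrt pT.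
have [/block_mx_sym[_ s12 s21 _] _] := S_posdef.
have uQ : Qs \in unitmx by move: u22; rewrite -sqrtS22P unitmx_mul => /andP[].
have tS11_gt0 i : 0 < tS11 i i.
  have [_ /(_ (delta_mx 0 i))] := pT.
  have -> : (delta_mx 0 i : 'rV[R]_n) != 0.
    by apply/eqP => /matrixP/(_ 0 i)/eqP; rewrite !mxE !eqxx oner_eq0.
  by move=> /(_ isT); rewrite -rowE trmx_delta -colE !mxE.
have par : HDQ_params Hs Ds Qs.
  split => //; first exact: diag_mx_is_diag.
  by move=> i; rewrite Delta_diagE ltW.
have HsQs : Hs *m Qs = S12 by rewrite mulmxKV.
have HsHs : Hs *m Hs^T = S12 *m invmx S22 *m S21.
  by rewrite trmx_mul s12 trmx_inv -sqrtS22P invmx_gram// !mulmxA.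
have SsE : Ss = block_mx (S12 *m invmx S22 *m S21 + Ds) S12 S21 S22.
  by rewrite /Ss /Sigma_of HsHs HsQs s12 sqrtS22P.
have S_Ss : S - Ss = block_mx (tS11 - Delta tS11) 0 0 0.
  by rewrite SsE /S opp_block_mx add_block_mx !subrr opprD addrA.
have detDs : 0 < \det Ds.
  by rewrite det_diag prodr_gt0// => i _; rewrite mxE.
have uDs : Ds \in unitmx by rewrite unitmxE unitfE gt_eqF.
have uSs : Ss \in unitmx.
  rewrite unitmxE /Ss det_Sigma_of// sqrtS22P unitrM.
  by rewrite -!unitmxE uDs u22.
have [Ass Ass_eq] := Sigma_of_sqrt par.
have dS := det_sqrt_gt0 AS_eq uS.
have dSs := det_sqrt_gt0 Ass_eq uSs.
have trSs : \tr (invmx Ss *m S) = (n + k)%:R.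
  by rewrite (mxtrace_invmx_Sigma_of par uSs S_Ss) mulVmx// mxtrace1.
have IS : Idiv S Ss = (2^-1 * ln (\det Ss / \det S))%:E.
  by rewrite (Idiv_unit AS_eq Ass_eq uS uSs) trSs subrr addr0.
have pyth (H : 'M[R]_(n, k)) (D : 'M[R]_n) (Q : 'M[R]_k) : HDQ_params H D Q ->
    Idiv S (Sigma_of H D Q) = (Idiv S Ss + Idiv Ss (Sigma_of H D Q))%E /\
    (0 <= Idiv Ss (Sigma_of H D Q))%E.
  move=> par1; have [A1 A1_eq] := Sigma_of_sqrt par1.
  have [u1|u1] := boolP (Sigma_of H D Q \in unitmx); last first.
    rewrite (Idiv_singular AS_eq A1_eq uS u1) (Idiv_singular Ass_eq A1_eq uSs u1).
    by rewrite IS addey ?leey.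
  split; last exact: Idiv_ge0 Ass_eq A1_eq uSs u1.
  have d1 := det_sqrt_gt0 A1_eq u1.
  rewrite (Idiv_unit AS_eq A1_eq uS u1) (Idiv_unit Ass_eq A1_eq uSs u1) IS.
  rewrite (mxtrace_invmx_Sigma_of par1 u1 S_Ss) -EFinD; congr _%:E.
  by rewrite !ln_div ?posrE//; ring.
split; [exact: par| |exact: SsE| |].
- move=> _ [H [D [Q [par1 ->]]]].
  by have [-> I0] := pyth _ _ _ par1; rewrite leeDl.
- have [AD AD_eq] : exists A : 'M[R]_n, A^T *m A = Ds.
    by case: par => Dd D0 _; exact: diag_sqrt Dd D0.
  rewrite IS (Idiv_unit AT_eq AD_eq uT uDs).
  have -> : \tr (invmx (Delta tS11) *m tS11) = n%:R.
    rewrite -[X in _ *m X](subrK (Delta tS11)) mulmxDr raddfD/=.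
    rewrite (mxtrace_Delta_eq0 _ (diag_mx_is_diag _) (mulVmx uDs)) add0r.
    by rewrite mulVmx// mxtrace1.
  rewrite subrr addr0 /Ss det_Sigma_of// sqrtS22P /S det_Schur//.
  rewrite invfM mulrACA divff ?mulr1//.
  by rewrite -unitfE -unitmxE.
- by move=> H D Q /pyth[].
Qed.
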